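(* Let $N\ge 0$ be an integer. Then the generating function of the hypergeometric Euler numbers of the second kind $\widehat E_{N,n}$ has the continued fraction expansion $$\sum_{n=0}^\infty \widehat E_{N,n}\frac{x^n}{n!}=1-\cfrac{x^2}{(2N+2)(2N+3)+x^2-\cfrac{(2N+2)(2N+3)x^2}{(2N+4)(2N+5)+x^2-\cfrac{(2N+4)(2N+5)x^2}{(2N+6)(2N+7)+x^2-\ddots}}}\,,$$ i.e. the continued fraction $a_0+\cfrac{b_1}{a_1+\cfrac{b_2}{a_2+\ddots}}$ with $a_0=1$, $b_1=-x^2$, $a_n=(2N+2n)(2N+2n+1)+x^2$ for $n\ge 1$, and $b_n=-(2N+2n-2)(2N+2n-1)x^2$ for $n\ge 2$.
   Context: The hypergeometric Euler numbers of the second kind $\widehat E_{N,n}$ are defined by $$\frac{1}{{}_1F_2(1;N+1,(2N+3)/2;x^2/4)}=\sum_{n=0}^\infty \widehat E_{N,n}\frac{x^n}{n!},$$ where ${}_1F_2(a;b,c;z)=\sum_{n=0}^\infty\frac{(a)^{(n)}}{(b)^{(n)}(c)^{(n)}}\frac{z^n}{n!}$ and $(y)^{(n)}=y(y+1)\cdots(y+n-1)$ for $n\ge 1$, $(y)^{(0)}=1$. Convention on continued fractions: for polynomials $a_n$ ($n\ge 0$), $b_n$ ($n\ge 1$) in $x$, the convergents $P_n/Q_n$ of $a_0+\cfrac{b_1}{a_1+\cfrac{b_2}{a_2+\ddots}}$ are defined by $P_{-1}=1$, $Q_{-1}=0$, $P_0=a_0$, $Q_0=1$, $P_n=a_nP_{n-1}+b_nP_{n-2}$,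 $Q_n=a_nQ_{n-1}+b_nQ_{n-2}$ ($n\ge 1$). A formal power series $f(x)$ has this continued fraction expansion (written as an equality) if for every $n\ge 0$ the power series expansion at $x=0$ of $P_n(x)/Q_n(x)$ agrees with $f(x)$ up to and including the term in $x^n$, i.e. $P_n/Q_n\equiv f\pmod{x^{n+1}}$; in particular $f=\lim_{n\to\infty}P_n/Q_n$ as formal power series. *)

(* Defs.v *)
From mathcomp Require Import all_boot all_order all_algebra.
Set Implicit Arguments.
Unset Strict Implicit.
Unset Printing Implicit Defensive.
Import GRing.Theory.
Local Open Scope ring_scope.

(* A formal power series is its sequence of coefficients; two series are
   compared extensionally, with [=1]. *)
Definition fps (R : Type) := nat -> R.

Section FormalPowerSeries.
Variable R : fieldType.
Implicit Types (a f g : fps R) (p q : {poly R}).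

Definition fps1 : fps R := fun n => (n == 0%N)%:R.

Definition fps_mul f g : fps R := fun n => \sum_(i < n.+1) f i * g (n - i)%N.

Definition fps_of_poly p : fps R := fun n => p`_n.

(* The first n coefficients of 1 / a, obtained by solving a * (1 / a) = 1
   degree by degree. *)
Fixpoint fps_inv_seq a (n : nat) : seq R :=
  if n is m.+1 then
    let s := fps_inv_seq a m in
    rcons s ((a 0%N)^-1 * (fps1 m - \sum_(i < m) s`_i * a (m - i)%N))
  else [::].

(* 1 / a, meaningful when a 0 != 0: see fps_mulV. *)
Definition fps_inv a : fps R := fun n => (fps_inv_seq a n.+1)`_n.

Lemma size_fps_inv_seq a n : size (fps_inv_seq a n) = n.
Proof. by elim: n => //= n IHn; rewrite size_rcons IHn. Qed.

Lemma nth_fps_inv_seq a n i : (i < n)%N -> (fps_inv_seq a n)`_i = fps_inv a i.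
Proof.
elim: n => // n IHn; rewrite ltnS leq_eqVlt => /predU1P[-> // | lt_in].
by rewrite /= nth_rcons size_fps_inv_seq lt_in IHn.
Qed.

Lemma fps_mulV a : a 0%N != 0 -> fps_mul (fps_inv a) a =1 fps1.
Proof.
move=> a0 n; rewrite /fps_mul big_ord_recr /= subnn {2}/fps_inv /=.
rewrite nth_rcons size_fps_inv_seq ltnn eqxx mulrAC mulVf // mul1r.
rewrite addrC -[RHS](subrK (\sum_(i < n) fps_inv a i * a (n - i)%N)).
congr (_ - _ + _).
by apply: eq_bigr => i _; rewrite nth_fps_inv_seq.
Qed.

(* The series f(c x^d), for d > 0. *)
Definition fps_subst f (c : R) (d : nat) : fps R :=
  fun n => if (d %| n)%N then f (n %/ d)%N * c ^+ (n %/ d) else 0.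

(* sum_n u_n x^n / n!  *)
Definition egf (u : nat -> R) : fps R := fun n => u n / n`!%:R.

Definition rising (y : R) (n : nat) : R := \prod_(i < n) (y + i%:R).

Definition hyp1F2 (a b c : R) : fps R :=
  fun n => rising a n / (rising b n * rising c n) / n`!%:R.

(* cf_rec a b u u' n = (u_n, u_(n-1)), where u_(-1) = u', u_0 = u and
   u_n = a_n u_(n-1) + b_n u_(n-2) for n >= 1. *)
Fixpoint cf_rec (a b : nat -> {poly R}) (u u' : {poly R}) (n : nat) :
    {poly R} * {poly R} :=
  if n is m.+1 then
    let v := cf_rec a b u u' m in (a n * v.1 + b n * v.2, v.1)
  else (u, u').

(* Numerators P_n and denominators Q_n of the convergents of
   a_0 + b_1 / (a_1 + b_2 / (a_2 + ...)); the value b 0 is not used. *)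
Definition cf_num (a b : nat -> {poly R}) n : {poly R} := (cf_rec a b (a 0%N) 1 n).1.
Definition cf_den (a b : nat -> {poly R}) n : {poly R} := (cf_rec a b 1 0 n).1.

(* g is the power series expansion at 0 of the rational function p / q. As
   power series over a field have no zero divisors, g is unique; q is allowed
   to vanish at 0 if p compensates for it. *)
Definition ratfun_expansion p q g : Prop :=
  q != 0 /\ fps_mul (fps_of_poly q) g =1 fps_of_poly p.

Definition cf_expansion f (a b : nat -> {poly R}) : Prop :=
  forall n, exists2 g, ratfun_expansion (cf_num a b n) (cf_den a b n) g &
    forall k, (k <= n)%N -> g k = f k.

End FormalPowerSeries.

Definition euler2_hyp (N : nat) : fps rat :=
  fps_subst (hyp1F2 1 (N%:R + 1) ((2 * N%:R + 3) / 2)) (1 / 4) 2.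

(* The hypergeometric Euler numbers of the second kind. *)
Definition euler2 (N n : nat) : rat := n`!%:R * fps_inv (euler2_hyp N) n.

Lemma euler2_hyp0 N : euler2_hyp N 0%N = 1.
Proof.
rewrite /euler2_hyp /fps_subst dvdn0 div0n /hyp1F2 /rising !big_ord0.
by rewrite expr0 fact0 !(mulr1, invr1).
Qed.

Lemma egf_euler2 N : egf (euler2 N) =1 fps_inv (euler2_hyp N).
Proof.
move=> n; rewrite /egf /euler2 mulrAC divff ?mul1r //.
by rewrite Num.Theory.pnatr_eq0 -lt0n fact_gt0.
Qed.

Lemma egf_euler2V N :
  fps_mul (egf (euler2 N)) (euler2_hyp N) =1 @fps1 rat.
Proof.
move=> n; rewrite -(@fps_mulV _ (euler2_hyp N)) ?euler2_hyp0 ?oner_neq0 //.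
by apply: eq_bigr => i _; rewrite egf_euler2.
Qed.

(* Main.v *)
Require Import Defs.
From mathcomp Require Import all_boot all_order all_algebra.
From mathcomp Require Import ring.
Import GRing.Theory.
Local Open Scope ring_scope.

(* Writing c_j = (2N+2j)(2N+2j+1), the hypergeometric series is
   F = sum_k x^(2k) / (c_1 ... c_k). By Euler's identity between series and
   continued fractions, the convergents are P_n = c_1 ... c_n and
   Q_n = P_n * (partial sum of F up to x^(2n)); hence P_n / Q_n is the inverse
   of a partial sum of F and agrees with 1 / F modulo x^(2n+2). *)

Section PowerSeries.
Variable R : fieldType.
Implicit Types (a b f g : fps R).

Lemma fps_mulC f g : fps_mul f g =1 fps_mul g f.
Proof.
move=> n; rewrite /fps_mul (reindex_inj rev_ord_inj) /=.
by apply: eq_bigr => i _; rewrite subSS (subKn (leq_ord i)) mulrC.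
Qed.

(** The inverse is solved for degree by degree, so its first [n] coefficients involve only those of
    index below [n] in the series; agreement up to a given degree thus passes to inverses. *)
Lemma eq_fps_inv_seq a b n :
  (forall i, (i < n)%N -> a i = b i) -> fps_inv_seq a n = fps_inv_seq b n.
Proof.
elim: n => //= n IHn eq_ab; rewrite IHn => [|i lt_in]; last first.
  by apply: eq_ab; apply: ltnW.
congr (rcons _ (_^-1 * (_ - _))); first exact: eq_ab.
by apply: eq_bigr => i _; rewrite eq_ab // ltnS leq_subr.
Qed.

Lemma eq_cf_expansion f g (a b : nat -> {poly R}) :
  f =1 g -> cf_expansion f a b -> cf_expansion g a b.
Proof.
move=> eq_fg cf_f n; have [h exp_h eq_hf] := cf_f n.
by exists h => // k le_kn; rewrite -eq_fg eq_hf.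
Qed.

Lemma cf_recS1 (a b : nat -> {poly R}) u u' n :
  (cf_rec a b u u' n.+1).1 =
    a n.+1 * (cf_rec a b u u' n).1 + b n.+1 * (cf_rec a b u u' n).2.
Proof. by []. Qed.

End PowerSeries.

Section EulerContinuedFraction.
Variables (R : fieldType) (c : nat -> R) (z : {poly R}).
Variables a b : nat -> {poly R}.
Hypothesis c_neq0 : forall n, c n != 0.
Hypothesis a0 : a 0%N = 1.
Hypothesis aS : forall n, a n.+1 = (c n)%:P + z.
Hypothesis b1 : b 1%N = - z.
Hypothesis bSS : forall n, b n.+2 = - (c n)%:P * z.

Let prodc n := \prod_(i < n) c i.

Lemma prodc_neq0 n : prodc n != 0.
Proof. by apply/prodf_neq0 => i _; apply: c_neq0. Qed.

(** Since [c n * prodc n = prodc n.+1], the two terms in [z] of the recurrence cancel, leaving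
    [P_(n+2) = c_(n+1) P_(n+1)]. *)
Lemma cf_num_euler n : cf_num a b n = (prodc n)%:P.
Proof.
(* The induction carries two consecutive terms and starts at index 1, as [b 1] does not follow the
   pattern of [bSS]. *)
suff: (cf_rec a b (a 0%N) 1 n.+1).1 = (prodc n.+1)%:P /\
      (cf_rec a b (a 0%N) 1 n.+1).2 = (prodc n)%:P by case.
elim: n => [|n [IH1 IH2]].
  by rewrite /= a0 aS b1 /prodc big_ord_recr !big_ord0 /= !mul1r !mulr1 addrK.
split; last exact: IH1.
rewrite cf_recS1 aS bSS IH1 IH2 /prodc !big_ord_recr /= !rmorphM /=; ring.
Qed.

Let psum n := \sum_(k < n.+1) (prodc k)^-1 *: z ^+ k.

(** By [step], [Q_(n+1) = c_n Q_n + z^(n+1)]. Hence [(c_(n+1) + z) Q_(n+1) - c_n z Q_n = c_(n+1)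
    Q_(n+1) + z (Q_(n+1) - c_n Q_n)], whose last term is [z^(n+2)]. *)
Lemma cf_den_euler n : cf_den a b n = prodc n *: psum n.
Proof.
have step m : prodc m.+1 *: psum m.+1 =
    c m *: (prodc m *: psum m) + z ^+ m.+1.
  rewrite {1}/psum big_ord_recr scalerDr [in X in _ + X]scalerA.
  rewrite mulfV ?prodc_neq0 // scale1r scalerA; congr (_ *: _ + _).
  by rewrite /prodc big_ord_recr mulrC.
have psum0 : prodc 0 *: psum 0 = 1.
  by rewrite /psum big_ord_recr big_ord0 /prodc big_ord0 /= invr1 !scale1r add0r.
suff: (cf_rec a b 1 0 n.+1).1 = prodc n.+1 *: psum n.+1 /\
      (cf_rec a b 1 0 n.+1).2 = prodc n *: psum n by case.
elim: n => [|n [IH1 IH2]].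
  by rewrite /= aS mulr0 addr0 step psum0 -alg_polyC expr1 mulr1.
split; last exact: IH1.
rewrite cf_recS1 aS bSS IH1 IH2 (step n.+1) (step n) -!mul_polyC !exprS; ring.
Qed.

End EulerContinuedFraction.

Lemma coef_sum_evenX (R : nzRingType) (u : nat -> R) n k : (k <= n)%N ->
  (\sum_(j < n.+1) u j *: ('X^2 ^+ j : {poly R}))`_k =
    if (2 %| k)%N then u (k %/ 2)%N else 0.
Proof.
move=> le_kn; rewrite coef_sum.
under eq_bigr => j _ do rewrite coefZ -exprM coefXn.
case: ifP => [k_even | k_odd].
  have lt_k : (k %/ 2 < n.+1)%N by rewrite ltnS (leq_trans (leq_div _ _)).
  rewrite (bigD1 (Ordinal lt_k)) //= muln_divA // mulKn // eqxx mulr1.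
  rewrite big1 ?addr0 // => j neq_j; case: eqP => [Dk | _]; last by rewrite mulr0.
  by case/eqP: neq_j; apply: val_inj; rewrite /= Dk mulKn.
rewrite big1 // => j _; case: eqP => [Dk | _]; last by rewrite mulr0.
by rewrite Dk dvdn_mulr in k_odd.
Qed.

Lemma cf_expansion_euler (R : fieldType) (c : nat -> R) (f : fps R)
    (a b : nat -> {poly R}) :
    (forall n, c n != 0) ->
    (forall k, f k = if (2 %| k)%N then (\prod_(i < k %/ 2) c i)^-1 else 0) ->
    a 0%N = 1 -> (forall n, a n.+1 = (c n)%:P + 'X^2) ->
    b 1%N = - 'X^2 -> (forall n, b n.+2 = - (c n)%:P * 'X^2) ->
  cf_expansion (fps_inv f) a b.
Proof.
move=> c_neq0 Df a0 aS b1 bSS n.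
set P := \prod_(i < n) c i.
have P_neq0 : P != 0 by apply: prodc_neq0.
pose s := \sum_(k < n.+1) (\prod_(i < k) c i)^-1 *: ('X^2 ^+ k : {poly R}).
have DP : cf_num a b n = P%:P by apply: cf_num_euler.
have DQ : cf_den a b n = P *: s by apply: cf_den_euler.
have s_f k : (k <= n)%N -> s`_k = f k.
  move=> le_kn; rewrite Df.
  by rewrite -(coef_sum_evenX _ (fun m => (\prod_(i < m) c i)^-1) n).
have s0 : s`_0 != 0 by rewrite s_f // Df big_ord0 invr1 oner_neq0.
(* The factor [P] common to numerator and denominator cancels, and [s] has constant term 1. *)
exists (fps_inv (fps_of_poly s)) => [|k le_kn].
  rewrite /ratfun_expansion DP DQ; split.
    rewrite scaler_eq0 negb_or P_neq0; apply: contraNneq s0 => ->.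
    by rewrite coef0.
  move=> m; rewrite /fps_of_poly coefC.
  have := @fps_mulV _ (fps_of_poly s) s0 m; rewrite fps_mulC /fps_mul => inv_s.
  under eq_bigr => i _ do rewrite coefZ -mulrA.
  by rewrite -mulr_sumr inv_s /fps1; case: eqP; rewrite ?mulr1 ?mulr0.
rewrite /fps_inv (@eq_fps_inv_seq _ _ f) // => i le_ik.
by apply: s_f; rewrite (leq_trans _ le_kn).
Qed.

Lemma risingS (R : fieldType) (y : R) n :
  rising y n.+1 = rising y n * (y + n%:R).
Proof. exact: big_ord_recr. Qed.

(** The rising factorial of 1 cancels [n!], and the factor 1/4 from the argument clears the halves:
    [4 (N+1+n) ((2N+3)/2+n) = (2N+2(n+1)) (2N+2(n+1)+1)]. *)
Lemma euler2_hypE N k : euler2_hyp N k =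
  if (2 %| k)%N then
    (\prod_(i < k %/ 2)
       ((2 * N%:R + 2 * i.+1%:R) * (2 * N%:R + 2 * i.+1%:R + 1)))^-1
  else 0.
Proof.
rewrite /euler2_hyp /fps_subst; case: ifP => // _.
rewrite /hyp1F2; elim: (k %/ 2)%N => [|n IHn].
  by rewrite /rising !big_ord0 expr0 fact0 !(mulr1, invr1).
rewrite [in RHS]big_ord_recr /= [RHS]invfM -IHn !risingS factS natrM exprS.
rewrite [n.+1%:R]mulrSr !invfM.
(* With the products up to [n] made opaque, only the new factors have to be compared. *)
move: (rising 1 n) (rising _ n)^-1 (rising _ n)^-1 (n`!%:R^-1) (_ ^+ n).
move=> r1 r2 r3 r4 r5; field.
rewrite !natr1 -!natrM -!natrD natr1 !Num.Theory.pnatr_eq0 !addn_eq0.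
by rewrite !negb_and orbT.
Qed.

Theorem theorem4 (N : nat) :
  cf_expansion (egf (euler2 N))
    (fun n : nat =>
       if n == 0%N then 1
       else ((2 * N%:R + 2 * n%:R) * (2 * N%:R + 2 * n%:R + 1))%:P + 'X^2)
    (fun n : nat =>
       if n == 1%N then - 'X^2
       else - ((2 * N%:R + 2 * n%:R - 2) * (2 * N%:R + 2 * n%:R - 1))%:P
            * 'X^2).
Proof.
apply: (eq_cf_expansion _ _ _ _ _ (fsym (egf_euler2 N))).
apply: (cf_expansion_euler _ _ _ _ _ _ (euler2_hypE N)) => // n.
  rewrite mulf_neq0 // -!natrM -natrD ?natr1 Num.Theory.pnatr_eq0 //.
  by rewrite addn_eq0 negb_and orbT.
(* The shift by one index is absorbed by [2(n+2) - 2 = 2(n+1)]. *)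
rewrite /= -!polyCN; congr (_%:P * _); rewrite ![n.+2%:R]mulrSr [n.+1%:R]mulrSr.
ring.
Qed.
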